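(* The map $f:\mathbb{R}^{S\times A}\to\mathbb{R}^{S\times A}$ is Fréchet differentiable almost everywhere with respect to Lebesgue measure on $\mathbb{R}^{S\times A}$.
   Context: Finite Markov decision process: $\mathcal S=\{1,\dots,S\}$ is a finite state space, $\mathcal A=\{a_1,\dots,a_A\}$ a finite action space, $p(i,j,a)$ is the probability of moving from state $i$ to state $j$ under action $a$ (so $p(i,j,a)\ge 0$, $\sum_j p(i,j,a)=1$), and $\beta\in(0,1)$ is the discount factor. The map $f:\mathbb{R}^{S\times A}\to\mathbb{R}^{S\times A}$ sends a cost matrix $\tilde c$ to the limit of the $Q$-learning algorithm run with cost $\tilde c$, i.e. to the unique $Q\in\mathbb{R}^{S\times A}$ satisfying $$Q(i,a)=\tilde c(i,a)+\beta\sum_{j\in\mathcal S}p(i,j,a)\min_{b\in\mathcal A}Q(j,b)\quad\text{for all } i\in\mathcal S,\ a\in\mathcal A.$$ *)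

(* Defs.v *)
From HB Require Import structures.
From mathcomp Require Import all_boot all_order all_algebra.
From mathcomp Require Import all_classical all_reals all_analysis.

Set Implicit Arguments.
Unset Strict Implicit.
Unset Printing Implicit Defensive.

Import Order.TTheory GRing.Theory Num.Theory.
Import numFieldNormedType.Exports.

Local Open Scope classical_set_scope.
Local Open Scope ring_scope.

(** Lebesgue measure on the space of real matrices, by the usual Caratheodory
    construction from the volume of boxes. The dimensions are successors
    because [box a b] is never empty in dimension 0. *)
Section lebesgue_mx.
Context {R : realType} {m n : nat}.
Local Notation M := 'M[R]_(m.+1, n.+1).

Definition mx_box (a b : M) : set M :=
  [set x | forall i j, x i j \in `]a i j, b i j]].

(* The truncation at 0 gives volume 0 to the empty boxes. *)
Definition mx_box_volume (a b : M) : R :=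
  \prod_i \prod_j Num.max 0 (b i j - a i j).

Definition mx_box_cover (X : set M) : set (nat -> M * M) :=
  [set ab | X `<=` \bigcup_k mx_box (ab k).1 (ab k).2].

Definition lebesgue_outer_mx (X : set M) : \bar R :=
  ereal_inf [set (\sum_(k <oo) (mx_box_volume (ab k).1 (ab k).2)%:E)%E
            | ab in mx_box_cover X].

Lemma mx_box_volume_ge0 a b : 0 <= mx_box_volume a b.
Proof. by do 2!apply: prodr_ge0 => ? _; rewrite le_max lexx. Qed.

Lemma mx_box_volume_eq0 : mx_box_volume 0 0 = 0.
Proof.
rewrite /mx_box_volume big_ord_recl big_ord_recl subrr maxxx.
by rewrite !mul0r.
Qed.

Lemma lebesgue_outer_mx_ge0 X : (0 <= lebesgue_outer_mx X)%E.
Proof.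
apply: le_ereal_inf_tmp => _ [ab _ <-]; apply: nneseries_ge0 => k _ _.
by rewrite lee_fin mx_box_volume_ge0.
Qed.

Lemma lebesgue_outer_mx0 : lebesgue_outer_mx set0 = 0%E.
Proof.
apply/eqP; rewrite eq_le lebesgue_outer_mx_ge0 andbT.
apply: ereal_inf_lbound; exists (fun=> (0, 0)); first by move=> x [].
by rewrite eseries0// => k _ _ /=; rewrite mx_box_volume_eq0.
Qed.

Lemma le_lebesgue_outer_mx :
  {homo lebesgue_outer_mx : X Y / X `<=` Y >-> (X <= Y)%E}.
Proof.
move=> X Y XY; apply: ereal_inf_le_tmp => _ [ab Yab <-].
by exists ab => //; exact: subset_trans Yab.
Qed.

Lemma lebesgue_outer_mx_sigma_subadditive :
  sigma_subadditive lebesgue_outer_mx.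
Proof.
move=> X; have [[i ioo]|] :=
    pselect (exists i, lebesgue_outer_mx (X i) = +oo%E).
  rewrite (eseries_pinfty _ _ ioo) ?leey// => k _.
  by rewrite -ltNye (lt_le_trans _ (lebesgue_outer_mx_ge0 _)).
rewrite -forallNE => Xoo; apply/lee_addgt0Pr => e e0.
rewrite (le_trans _ (epsilon_trick _ _ (ltW e0)))//; last first.
  by move=> k; exact: lebesgue_outer_mx_ge0.
pose vol (ab : M * M) : \bar R := (mx_box_volume ab.1 ab.2)%:E.
have vol0 ab : (0 <= vol ab)%E by rewrite lee_fin mx_box_volume_ge0.
have [G PG] : {G : nat -> nat -> M * M & forall k, mx_box_cover (X k) (G k) /\
    (\sum_(l <oo) vol (G k l) <=
      lebesgue_outer_mx (X k) + (e / (2 ^ k.+1)%:R)%:E)%E}.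
  apply: (@choice _ _ (fun k ab => mx_box_cover (X k) ab /\
    (\sum_(l <oo) vol (ab l) <=
      lebesgue_outer_mx (X k) + (e / (2 ^ k.+1)%:R)%:E)%E)) => k.
  have Xfin : lebesgue_outer_mx (X k) \is a fin_num.
    by rewrite ge0_fin_numE ?lebesgue_outer_mx_ge0// ltey; exact/eqP/Xoo.
  have ek : 0 < e / (2 ^ k.+1)%:R by rewrite divr_gt0// ltr0n expn_gt0.
  have [_ [ab Xab <-] /ltW le_ab] := lb_ereal_inf_adherent ek Xfin.
  by exists ab.
apply: (@le_trans _ _ (\esum_(i in setT) (vol \o uncurry G) i)%E).
  apply: ereal_inf_lbound.
  have /card_esym/ppcard_eqP[f] := card_nat2.
  exists (uncurry G \o f).
    move=> x [k _ /(PG k).1[l _ Gx]].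
    by exists (f^-1%FUN (k, l)) => //=; rewrite invK ?inE.
  rewrite -(esum_pred_image (vol \o uncurry G) _ xpredT) ?[fun=> _]set_true//.
    by rewrite image_eq.
  by move=> *; exact: vol0.
rewrite (_ : esum _ _ = \sum_(i <oo) \sum_(j <oo) vol (G i j))%E.
  by apply: lee_nneseries => // k _; [move=> _; exact: nneseries_ge0|
    exact: (PG k).2].
pose J k : set (nat * nat) := [set (k, l) | l in setT].
rewrite (_ : setT = \bigcup_k J k); last first.
  by rewrite predeqE => -[a b]; split => // _; exists a => //; exists b.
rewrite esum_bigcupT /=; last 2 first.
- apply/trivIsetP => i j _ _ ij.
  rewrite predeqE => -[? ?] /=; split => //= -[] [_] _ [<- _].
  by move=> [? _] [] /esym/eqP; rewrite (negbTE ij).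
- by move=> ?; exact: vol0.
rewrite -(image_id [set: nat]) -fun_true esum_pred_image//; last first.
  by move=> k _; exact: esum_ge0.
apply: eq_eseriesr => /= j _.
rewrite -(esum_pred_image (vol \o uncurry G) (pair j) predT)//=; last first.
  by move=> ? ? _ _; exact: (@can_inj _ _ _ snd).
by congr esum; rewrite predeqE => -[a b]; split; move=> [i _ <-]; exists i.
Qed.

HB.instance Definition _ := isOuterMeasure.Build R M lebesgue_outer_mx
  lebesgue_outer_mx0 lebesgue_outer_mx_ge0 le_lebesgue_outer_mx
  lebesgue_outer_mx_sigma_subadditive.

End lebesgue_mx.

Section lebesgue_measure_mx.
Context {R : realType} {m n : nat}.

Definition lebesgue_measure_mx :
    set (caratheodory_type (@lebesgue_outer_mx R m n)) -> \bar R :=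
  lebesgue_outer_mx.

Let measure0 : lebesgue_measure_mx set0 = 0%E.
Proof. exact: lebesgue_outer_mx0. Qed.

Let measure_ge0 X : (0 <= lebesgue_measure_mx X)%E.
Proof. exact: lebesgue_outer_mx_ge0. Qed.

Let measure_semi_sigma_additive : semi_sigma_additive lebesgue_measure_mx.
Proof. exact: caratheodory_measure_sigma_additive. Qed.

HB.instance Definition _ := isMeasure.Build _ _ _ lebesgue_measure_mx
  measure0 measure_ge0 measure_semi_sigma_additive.

End lebesgue_measure_mx.

(* Joins the library's completeness and norm structures on matrices, for
   Banach's fixed point theorem. *)
HB.instance Definition _ (R : realType) (m n : nat) :=
  Complete.on 'M[R]_(m, n).

(** Finite Markov decision processes with nS.+1 states and nA.+1 actions;
    [p i j a] is the probability of moving from i to j under action a. *)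
Section q_learning_limit.
Context {R : realType} {nS nA : nat}.
Local Notation M := 'M[R]_(nS.+1, nA.+1).
Implicit Types (p : 'I_nS.+1 -> 'I_nS.+1 -> 'I_nA.+1 -> R) (beta : R).
Implicit Types c Q : M.

Definition row_min Q (j : 'I_nS.+1) : R :=
  \big[Num.min/Q j ord0]_(b < nA.+1) Q j b.

Definition bellman p beta c Q : M :=
  \matrix_(i, a) (c i a + beta * \sum_j p i j a * row_min Q j).

(* [get] returns an arbitrary matrix if no fixed point exists; see
   [q_limitP] for existence and uniqueness. *)
Definition q_limit p beta c : M := get [set Q | Q = bellman p beta c Q].

Lemma row_min_lipschitz Q Q' j : `|row_min Q j - row_min Q' j| <= `|Q - Q'|.
Proof.
have entry (X Y : M) b : X j b <= `|X - Y| + Y j b.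
  rewrite -lerBlDr; apply: le_trans (ler_norm _) _.
  rewrite [leRHS]/Num.norm/= mx_normrE.
  have := @le_bigmax _ _ _ 0
    (fun ij : 'I_nS.+1 * 'I_nA.+1 => `|(X - Y) ij.1 ij.2|) (j, b).
  by rewrite /= !mxE.
have half (X Y : M) : row_min X j - row_min Y j <= `|X - Y|.
  rewrite lerBlDr -lerBlDl /row_min; apply: le_bigmin => [|b _]; rewrite lerBlDl.
    by apply: le_trans (entry X Y ord0); exact: bigmin_le.
  by apply: le_trans (entry X Y b); exact: bigmin_le.
by rewrite ler_norml half andbT lerNl opprB distrC half.
Qed.

Lemma q_limitP p beta c :
  (forall i j a, 0 <= p i j a) -> (forall i a, \sum_j p i j a = 1) ->
  0 < beta < 1 ->
  forall Q, Q = bellman p beta c Q <-> Q = q_limit p beta c.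
Proof.
move=> p0 p1 /andP[b0 b1].
pose T : {fun [set: M] >-> [set: M]} := totalfun (bellman p beta c).
have ctr : is_contraction T.
  exists (NngNum (ltW b0)); split => // -[Q Q'] _ /=.
  rewrite [leLHS]/Num.norm/= mx_normrE; apply: bigmax_le => [|[i a] _ /=].
    by rewrite mulr_ge0// ltW.
  rewrite !mxE opprD addrACA subrr add0r -mulrBr normrM gtr0_norm// ler_pM2l//.
  rewrite -sumrB (le_trans (ler_norm_sum _ _ _))//.
  rewrite -[leRHS]mul1r -(p1 i a) mulr_suml; apply: ler_sum => j _.
  by rewrite -mulrBr normrM ger0_norm// ler_wpM2l// row_min_lipschitz.
have [Q0 _ fixQ0] := banach_fixed_point ctr closedT (ex_intro _ 0 I).
have fixq : q_limit p beta c = bellman p beta c (q_limit p beta c).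
  by apply: (@getPex _ [set Q | Q = bellman p beta c Q]); exists Q0.
move=> Q; split => [fixQ|->//].
exact: (contraction_fixpoint_unique ctr).
Qed.

End q_learning_limit.

(* Main.v *)
Require Import Defs.
From HB Require Import structures.
From mathcomp Require Import all_boot all_order all_algebra.
From mathcomp Require Import all_classical all_reals all_analysis.
From mathcomp Require Import ring lra.

Set Implicit Arguments.
Unset Strict Implicit.
Unset Printing Implicit Defensive.

Import Order.TTheory GRing.Theory Num.Theory.
Import numFieldNormedType.Exports.
Local Open Scope classical_set_scope.
Local Open Scope ring_scope.

(** For a deterministic policy d, the map Q |-> Q - beta P_d Q is linear, and
    injective because beta P_d is a sup-norm contraction; let B_d be its
    inverse. If d picks a minimal action in each row of Q = f(c), then
    Q = B_d c. When moreover no two entries in one row of B_d c are equal, d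
    strictly minimizes each row of B_d c' for all c' near c, so that f agrees
    with the linear map B_d near c. Hence f is differentiable outside the
    finitely many sets {c | (B_d c) j b = (B_d c) j b'} with b != b', which are
    hyperplanes because B_d is onto, and hyperplanes are Lebesgue null. *)

(** * Preliminaries on norms, outer measure and boxes *)

Lemma mx_entry_le_norm (R : realType) (m n : nat) (x : 'M[R]_(m.+1, n.+1)) i j :
  `|x i j| <= `|x|.
Proof.
rewrite [leRHS]/Num.norm/= mx_normrE.
exact: (@le_bigmax _ _ _ 0
  (fun ij : 'I_m.+1 * 'I_n.+1 => `|x ij.1 ij.2|) (i, j)).
Qed.

Lemma outer_measure_bigsetU (R : realType) (T : Type)
    (mu : {outer_measure set T -> \bar R}) (I : Type) (s : seq I)
    (P : pred I) (F : I -> set T) :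
  (mu (\big[setU/set0]_(i <- s | P i) F i) <= \sum_(i <- s | P i) mu (F i))%E.
Proof.
elim/big_ind2 : _ => [|X x Y y Xx Yy|//]; first by rewrite outer_measure0.
by rewrite (le_trans (outer_measureU2 _ _ _))// leeD.
Qed.

Lemma lebesgue_outer_mx_box (R : realType) (m n : nat)
    (a b : 'M[R]_(m.+1, n.+1)) :
  (lebesgue_outer_mx (mx_box a b) <= (mx_box_volume a b)%:E)%E.
Proof.
apply: ereal_inf_lbound.
(* The sequence is padded with the box from 0 to 0, whose volume is 0. *)
exists (fun k => if k is 0 then (a, b) else (0, 0)).
  by move=> x abx; exists 0%N.
rewrite (nneseries_split 0 1)/=; last first.
  by move=> k _; rewrite lee_fin mx_box_volume_ge0.
rewrite big_nat1 eseries0 ?adde0// => -[//|k] _ _.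
by rewrite mx_box_volume_eq0.
Qed.

(** The cells are open on the left, as the boxes are; after translation and scaling they subdivide
    one side of a cube. *)
Lemma unit_cell_exists (R : realType) (N : nat) (y : R) :
  0 < y <= N%:R -> exists k : 'I_N, k%:R < y <= k.+1%:R.
Proof.
elim: N => [|N IH] /andP[y0 yN].
  by have := lt_le_trans y0 yN; rewrite ltxx.
have [yN'|Ny] := leP y N%:R; last by exists ord_max; rewrite /= Ny yN.
have [|k ky] := IH; first by rewrite y0 yN'.
by exists (widen_ord (leqnSn N) k).
Qed.

Lemma le0_all_div (R : realType) (x : \bar R) (c : R) :
  (forall N : nat, (x <= (c / N.+1%:R)%:E)%E) -> (x <= 0)%E.
Proof.
move=> xc; apply/lee_addgt0Pr => e e0; rewrite add0e.
(* With this N, N + 1 exceeds |c| / e. *)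
apply: (le_trans (xc (Num.truncn (`|c| / e)))); rewrite lee_fin.
have /andP[_ h] := truncn_itv (divr_ge0 (normr_ge0 c) (ltW e0)).
rewrite ler_pdivrMr ?ltr0n// mulrC -ler_pdivrMr//.
by apply: le_trans (ltW h); rewrite ler_pM2r ?invr_gt0// ler_norm.
Qed.

(** * Hyperplanes are Lebesgue null *)

Section hyperplane.
Context {R : realType} {m n : nat}.
Local Notation M := 'M[R]_(m.+1, n.+1).
Local Notation I := ('I_m.+1 * 'I_n.+1)%type.

(* In a cube cut into N^D cells, D the number of entries, the graph of a
   Lipschitz function of the entries other than e0 is covered by one box of
   height O(1/N) for each of the N^(D-1) cells of the remaining entries. These
   cells are indexed by the functions k with value ord0 at e0. *)
Lemma lebesgue_outer_mx_graph_cube (w : M) (e0 : I) (K : nat) :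
  lebesgue_outer_mx [set x : M |
    x e0.1 e0.2 = \sum_(e | e != e0) w e.1 e.2 * x e.1 e.2 /\
    forall i j, - K.+1%:R < x i j <= K.+1%:R] = 0%E.
Proof.
set H := (X in lebesgue_outer_mx X).
apply/eqP; rewrite eq_le outer_measure_ge0 andbT.
(* The sum is a sup-norm Lipschitz constant; the extra 1 makes the distance to [L k] strictly less
   than [C * h], as boxes exclude their lower ends. *)
pose C : R := 1 + \sum_(e | e != e0) `|w e.1 e.2|.
have C0 : 0 < C by rewrite ltr_pwDl// sumr_ge0.
pose s : R := K.+1%:R *+ 2.
have s0 : 0 < s by rewrite mulrn_wgt0// ltr0n.
pose d := #|predC1 e0|.
(* With h = s / (N + 1), there are (N + 1)^d boxes of volume at most 2 C h^(d+1), in total 2 C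
   s^(d+1) / (N + 1). *)
apply: (@le0_all_div _ _ (C *+ 2 * s ^+ d.+1)) => N.
pose h : R := s / N.+1%:R.
have h0 : 0 < h by rewrite divr_gt0// ltr0n.
(* [q k] is the lower corner of the cell [k], and [L k] the linear function there. *)
pose q (k : {ffun I -> 'I_N.+1}) e : R := - K.+1%:R + h * (k e)%:R.
pose L k : R := \sum_(e | e != e0) w e.1 e.2 * q k e.
pose a k : M := \matrix_(i, j)
  if (i, j) == e0 then L k - C * h else q k (i, j).
pose b k : M := \matrix_(i, j)
  if (i, j) == e0 then L k + C * h else q k (i, j) + h.
pose S := pffun_on (ord0 : 'I_N.+1) (predC1 e0) predT.
have HS : H `<=` \big[setU/set0]_(k in S) mx_box (a k) (b k).
  move=> x [xe0 xK].
  have cell e : exists k : 'I_N.+1,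
      - K.+1%:R + h * k%:R < x e.1 e.2 <= - K.+1%:R + h * k%:R + h.
    have /andP[x1 x2] := xK e.1 e.2.
    have [|k /andP[k1 k2]] :=
        @unit_cell_exists R N.+1 ((x e.1 e.2 + K.+1%:R) / h).
      rewrite divr_gt0 ?ler_pdivrMr//=; last by rewrite -ltrBlDr sub0r.
      by rewrite /h mulrCA divff ?pnatr_eq0// mulr1 /s mulr2n lerD2r.
    exists k; move: k1 k2; rewrite ltr_pdivlMr// ler_pdivrMr// -[k.+1%:R]natr1.
    by rewrite mulrDl mul1r [h * _]mulrC => ? ?; apply/andP; split; lra.
  have [k0 k0P] := choice cell.
  pose k : {ffun I -> 'I_N.+1} :=
    [ffun e => if e == e0 then ord0 else k0 e].
  have kq e : e != e0 -> q k e < x e.1 e.2 <= q k e + h.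
    by move=> ee0; rewrite /q ffunE (negbTE ee0).
  have kS : k \in S.
    apply/pffun_onP; split => [|? _//].
    apply/supportP => e; rewrite inE negbK => /eqP->.
    by rewrite ffunE eqxx.
  have xL : `|x e0.1 e0.2 - L k| < C * h.
    rewrite xe0 -sumrB (le_lt_trans (ler_norm_sum _ _ _))//.
    rewrite mulrDl mul1r mulr_suml ltr_pwDl// ler_sum// => e ee0.
    rewrite -mulrBr normrM ler_wpM2l// ler_norml.
    by have /andP[? ?] := kq _ ee0; apply/andP; split; lra.
  rewrite -bigcup_pred; exists k => //= i j; rewrite in_itv/= !mxE.
  case: ifPn => [/eqP ije0|/kq//].
  by move: xL; rewrite -ije0/= ltr_norml => /andP[? ?]; apply/andP; split; lra.
apply: (le_trans (le_lebesgue_outer_mx HS)).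
apply: (le_trans (outer_measure_bigsetU lebesgue_outer_mx _ _ _)).
apply: (@le_trans _ _ (\sum_(k in S) (C *+ 2 * h ^+ d.+1)%:E)%E).
  apply: lee_sum => k _; apply: le_trans (lebesgue_outer_mx_box _ _) _.
  rewrite lee_fin /mx_box_volume pair_bigA/= (bigD1 e0)//=.
  rewrite (eq_bigr (fun=> h)) => [|[i j] ije0]; last first.
    rewrite !mxE (negbTE ije0) addrC addKr.
    by apply/max_idPr; exact: ltW.
  rewrite prodr_const !mxE -surjective_pairing eqxx.
  rewrite exprS mulrA ler_pM2r ?exprn_gt0// (_ : _ + _ - _ = C *+ 2 * h).
    by rewrite ge_max lexx andbT mulr_ge0 ?mulrn_wge0 ?ltW.
  by ring.
rewrite sumEFin lee_fin sumr_const card_pffun_on card_ord -/d.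
rewrite -[_ *+ (_ ^ _)%N]mulr_natr.
rewrite le_eqVlt; apply/orP; left; apply/eqP.
rewrite natrX /h expr_div_n exprS [_ ^+ d.+1 in X in _ / X]exprS.
have : N.+1%:R != 0 :> R by rewrite pnatr_eq0.
have : N.+1%:R ^+ d != 0 :> R by rewrite expf_neq0// pnatr_eq0.
by move=> *; field; apply/andP.
Qed.

(** Solving for an entry with nonzero coefficient gives a graph, which is a countable union of its
    null parts in growing cubes. *)
Lemma lebesgue_outer_mx_hyperplane (w : M) : w != 0 ->
  lebesgue_outer_mx [set x : M | \sum_i \sum_j w i j * x i j = 0] = 0%E.
Proof.
move=> w0.
have [e0 we0] : exists e0 : I, w e0.1 e0.2 != 0.
  apply/existsP; apply: contraNT w0 => /existsPn w0.
  by apply/eqP/matrixP => i j; rewrite mxE; have /negPn/eqP := w0 (i, j).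
pose v : M := - (w e0.1 e0.2)^-1 *: w.
pose G K := [set x : M |
    x e0.1 e0.2 = \sum_(e | e != e0) v e.1 e.2 * x e.1 e.2 /\
    forall i j, - K.+1%:R < x i j <= K.+1%:R].
apply/eqP; rewrite eq_le outer_measure_ge0 andbT.
have HG : [set x : M | \sum_i \sum_j w i j * x i j = 0] `<=` \bigcup_K G K.
  move=> x /=; rewrite pair_bigA/= (bigD1 e0)//= => wx.
  exists (Num.truncn `|x|) => //; split.
    move/eqP : wx; rewrite addr_eq0 => /eqP wx.
    apply: (mulfI we0); rewrite wx mulr_sumr -sumrN; apply: eq_bigr => e _.
    by rewrite mxE mulNr mulNr mulrN -mulrA mulVKf.
  move=> i j; have /andP[_ xK] := truncn_itv (normr_ge0 x).
  have := le_lt_trans (mx_entry_le_norm x i j) xK.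
  by rewrite ltr_norml => /andP[-> /ltW ->].
apply: (le_trans (le_lebesgue_outer_mx HG)).
apply: (le_trans (lebesgue_outer_mx_sigma_subadditive _)).
rewrite eseries0// => K _ _; exact: lebesgue_outer_mx_graph_cube.
Qed.

End hyperplane.

(** * Negligible sets and differentiability *)

Lemma outer_null_negligible (R : realType) (m n : nat)
    (X : set 'M[R]_(m.+1, n.+1)) :
  lebesgue_outer_mx X = 0%E -> (@lebesgue_measure_mx R m n).-negligible X.
Proof.
move=> X0; exists X; split => //.
(* Of the two pieces into which [X] cuts [Y], the one inside [X] has outer measure 0 by
   monotonicity. *)
apply: le_caratheodory_measurable => Y.
have YX0 : lebesgue_outer_mx (Y `&` X) = 0%E.
  apply/eqP; rewrite eq_le outer_measure_ge0 andbT -X0.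
  exact: le_lebesgue_outer_mx (@subIsetr _ _ _).
rewrite [X in (X + _)%E]YX0 add0e.
exact: le_lebesgue_outer_mx (@subIsetl _ _ _).
Qed.

(** The first-order expansion of [g] also holds for [f], and uniqueness of the differential
    identifies ['d f x] with ['d g x]. *)
Lemma near_eq_differentiable (R : numFieldType) (V W : normedModType R)
    (f g : V -> W) (x : V) :
  (\forall y \near x, f y = g y) -> differentiable g x -> differentiable f x.
Proof.
move=> fg dg.
have fgx : f x = g x by exact: nbhs_singleton fg.
have dfE : f \o shift x = cst (f x) + 'd g x +o_ 0 id.
  apply/eqaddoP => _/posnumP[e].
  have /eqaddoP/(_ e%:num (gt0 e)) := diff_locally dg.
  have : \forall h \near 0, f (h + x) = g (h + x).
    by move: fg; rewrite (near_shift 0)/= subr0.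
  by apply: filterS2 => h /= fgh; rewrite !fctE /= fgh fgx.
apply/diff_locallyP.
rewrite (diff_unique (diff_continuous dg) dfE); split => //.
exact: diff_continuous.
Qed.

(** In the basis [delta_mx i j] the map is a finite sum of coordinates times fixed vectors. *)
Lemma linear_mx_continuous (R : realType) (m n : nat) (V : normedModType R)
    (f : {linear 'M[R]_(m.+1, n.+1) -> V}) : continuous f.
Proof.
have -> : (f : _ -> _) =
    fun x : 'M[R]_(m.+1, n.+1) => \sum_i \sum_j x i j *: f (delta_mx i j).
  apply/funext => x; rewrite {1}(matrix_sum_delta x) linear_sum.
  apply: eq_bigr => i _; rewrite linear_sum.
  by apply: eq_bigr => j _; rewrite linearZ.
apply: continuous_big => [|i _]; first exact: add_continuous.
apply: continuous_big => [|j _ x]; first exact: add_continuous.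
exact: (@cvgZr_tmp _ _ _ (nbhs x) (nbhs_filter x)
  (fun y : 'M[R]_(m.+1, n.+1) => y i j) _ _ (@coord_continuous R _ _ i j x)).
Qed.

(** * Deterministic policies and their ties *)

Section policy.
Context {R : realType} {nS nA : nat}.
Local Notation M := 'M[R]_(nS.+1, nA.+1).
Variables (p : 'I_nS.+1 -> 'I_nS.+1 -> 'I_nA.+1 -> R) (beta : R).
Implicit Types (d : {ffun 'I_nS.+1 -> 'I_nA.+1}) (Q c : M).

(** The cost whose action-value function under the policy [d] is [Q]. *)
Definition policy_cost d Q : M :=
  \matrix_(i, a) (Q i a - beta * \sum_j p i j a * Q j (d j)).

Lemma policy_cost_linear d : linear (policy_cost d).
Proof.
move=> k Q Q'; apply/matrixP => i a; rewrite !mxE.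
under eq_bigr do rewrite !mxE mulrDr mulrCA.
by rewrite big_split/= -mulr_sumr; ring.
Qed.

HB.instance Definition _ d := GRing.isLinear.Build R M M _ (policy_cost d)
  (policy_cost_linear d).

(** The inverse of linear maps is a total operation; triviality of the kernel, shown below, makes it
    two-sided here. *)
Definition policy_value d : 'End(M) := ((linfun (policy_cost d))^-1)%VF.

Hypotheses (p_ge0 : forall i j a, 0 <= p i j a)
  (p_sum1 : forall i a, \sum_j p i j a = 1) (beta01 : 0 < beta < 1).

(** A kernel element D is beta times averages of its own entries, so |D| <= beta |D|, and beta < 1
    forces D = 0. *)
Lemma policy_cost_ker d : lker (linfun (policy_cost d)) == 0%VS.
Proof.
have /andP[b0 b1] := beta01.
apply/lker0P => Q Q'; rewrite !lfunE/= => QQ'; apply/eqP.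
rewrite -subr_eq0; set D := Q - Q'.
have D0 : policy_cost d D = 0 by rewrite linearB/= QQ' subrr.
have : `|D| <= beta * `|D|.
  rewrite [leLHS]/Num.norm/= mx_normrE; apply: bigmax_le => [|[i a] _ /=].
    by rewrite mulr_ge0// ltW.
  move/matrixP/(_ i a) : D0; rewrite mxE [RHS]mxE => /subr0_eq ->.
  rewrite normrM gtr0_norm// ler_pM2l// (le_trans (ler_norm_sum _ _ _))//.
  rewrite -[leRHS]mul1r -(p_sum1 i a) mulr_suml; apply: ler_sum => j _.
  by rewrite normrM ger0_norm// ler_wpM2l// mx_entry_le_norm.
by rewrite -normr_le0 => Db; have := normr_ge0 D; nra.
Qed.

Lemma policy_costK d : cancel (policy_cost d) (policy_value d).
Proof.
by move=> Q; rewrite -[X in policy_value d X]lfunE lker0_lfunK ?policy_cost_ker.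
Qed.

Lemma policy_valueK d : cancel (policy_value d) (policy_cost d).
Proof.
by move=> Q; rewrite -[LHS]lfunE lker0_lfunVK ?policy_cost_ker.
Qed.

(** Once [d] selects the row minima, the Bellman equation becomes linear. *)
Lemma bellman_fixE d c Q : (forall j, row_min Q j = Q j (d j)) ->
  Q = bellman p beta c Q <-> policy_cost d Q = c.
Proof.
move=> Qd; split => [QE|<-]; apply/matrixP => i a.
  rewrite mxE [in X in X - _]QE mxE; under eq_bigr do rewrite Qd.
  by rewrite addrK.
by rewrite !mxE; under [X in _ - _ + _ * X]eq_bigr do rewrite Qd; rewrite subrK.
Qed.

Lemma row_min_attained Q : exists d, forall j, row_min Q j = Q j (d j).
Proof.
have attained j : exists b, row_min Q j = Q j b.
  rewrite /row_min; elim/big_ind : _ => [|x y [b ->] [b' ->]|b _].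
  - by exists ord0.
  - by case: (leP (Q j b) (Q j b')) => _; [exists b|exists b'].
  - by exists b.
have [d dE] := choice attained.
by exists [ffun j => d j] => j; rewrite ffunE.
Qed.

Lemma row_min_le Q j b : row_min Q j <= Q j b.
Proof. exact: bigmin_le. Qed.

Lemma row_minE Q j b : (forall b', Q j b <= Q j b') -> row_min Q j = Q j b.
Proof.
move=> Qb; apply/eqP; rewrite eq_le row_min_le/=.
by apply: le_bigmin => *; exact: Qb.
Qed.

Definition tie d j b b' : set M :=
  [set c | policy_value d c j b = policy_value d c j b'].

Lemma tie_null d j b b' : b != b' -> lebesgue_outer_mx (tie d j b b') = 0%E.
Proof.
move=> bb'.
pose w : M := \matrix_(i, a)
  (policy_value d (delta_mx i a) j b - policy_value d (delta_mx i a) j b').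
have wE c : \sum_i \sum_a w i a * c i a =
    policy_value d c j b - policy_value d c j b'.
  rewrite {2 3}(matrix_sum_delta c) !linear_sum !summxE -sumrB.
  apply: eq_bigr => i _; rewrite !linear_sum !summxE -sumrB.
  by apply: eq_bigr => a _; rewrite !linearZ !mxE mulrBl -!(mulrC (c i a)).
have w0 : w != 0.
  (* [policy_value d] sends this cost to [delta_mx j b], so the functional takes the value 1
     there. *)
  apply/eqP => w0; have := wE (policy_cost d (delta_mx j b)).
  rewrite policy_costK !mxE !eqxx eq_sym (negbTE bb')/= subr0 big1.
    by move/eqP; rewrite eq_sym oner_eq0.
  by move=> i _; rewrite big1// => a _; rewrite w0 mxE mul0r.
rewrite -(lebesgue_outer_mx_hyperplane w0); congr lebesgue_outer_mx.
apply/seteqP; split => c; rewrite /tie /= wE; first by move=> ->; rewrite subrr.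
exact: subr0_eq.
Qed.

Lemma q_limit_differentiable c :
  (forall d j b b', b != b' -> ~ tie d j b b' c) ->
  differentiable (q_limit p beta) c.
Proof.
move=> ntie; have [d dE] := row_min_attained (q_limit p beta c).
have /(bellman_fixE _ dE) cE :
    q_limit p beta c = bellman p beta c (q_limit p beta c).
  exact/q_limitP.
have {cE} qE : q_limit p beta c = policy_value d c.
  by rewrite -[in RHS]cE policy_costK.
have Bcont : continuous (policy_value d) by exact: linear_mx_continuous.
apply: (@near_eq_differentiable _ _ _ _ (policy_value d)); last first.
  exact: linear_differentiable.
(* Each strict inequality persists near [c] by continuity, and there are finitely many. *)
have lt_near : \forall c' \near c, forall jb : 'I_nS.+1 * 'I_nA.+1,
    jb.2 != d jb.1 ->
    policy_value d c' jb.1 (d jb.1) < policy_value d c' jb.1 jb.2.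
  apply: (@filter_forall _ _ _ (nbhs c) (nbhs_filter c)) => -[j b] /=.
  have [->|bd] := eqVneq b (d j); first by apply: nearW.
  have lt_c : policy_value d c j (d j) < policy_value d c j b.
    rewrite lt_neqAle -qE -dE row_min_le andbT dE qE.
    by apply/eqP => /esym; exact: ntie.
  have coord k : policy_value d c' j k @[c' --> c] --> policy_value d c j k.
    exact: (continuous_comp (Bcont c) (@coord_continuous R _ _ j k _)).
  have := cvgr_gt _ (cvgB (coord b) (coord (d j))) 0.
  rewrite subr_gt0 => /(_ (nbhs_filter c) (nbhs_filter c) lt_c).
  apply: filterS => c' /=.
  by rewrite subr_gt0.
apply: filterS lt_near => c' lt_c'.
(* By uniqueness of the fixed point, it suffices that [policy_value d c'] solves the Bellman
   equation for [c']. *)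
apply/esym/q_limitP => //; apply/(bellman_fixE _ (d := d)).
  move=> j; apply: row_minE => b; have [->//|bd] := eqVneq b (d j).
  exact: ltW (lt_c' (j, b) bd).
exact: policy_valueK.
Qed.

End policy.

Theorem mainTheorem5 (R : realType) (nS nA : nat)
    (p : 'I_nS.+1 -> 'I_nS.+1 -> 'I_nA.+1 -> R) (beta : R)
    (p_ge0 : forall i j a, 0 <= p i j a)
    (p_sum1 : forall i a, \sum_j p i j a = 1)
    (beta01 : 0 < beta < 1) :
  {ae @lebesgue_measure_mx R nS nA, forall c : 'M[R]_(nS.+1, nA.+1),
    differentiable (q_limit p beta) c}.
Proof.
pose F (t : {ffun 'I_nS.+1 -> 'I_nA.+1} * 'I_nS.+1 * 'I_nA.+1 * 'I_nA.+1) :=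
  let: (d, j, b, b') := t in tie p beta d j b b'.
(* Equal actions are excluded, since their tie is the whole space. *)
pose X := \big[setU/set0]_(t | t.1.2 != t.2) F t.
apply: (@negligibleS _ _ _ (@lebesgue_measure_mx R nS nA) X).
  move=> c; apply: contra_notP => cX.
  apply: q_limit_differentiable => // d j b b' bb' ctie; apply: cX.
  by rewrite /X -bigcup_pred; exists (d, j, b, b').
apply: outer_null_negligible; apply/eqP.
rewrite eq_le outer_measure_ge0 andbT.
apply: (le_trans (outer_measure_bigsetU lebesgue_outer_mx _ _ _)).
rewrite big1// => -[[[d j] b] b'] /= bb'; exact: tie_null.
Qed.
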